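(* There exists a locally finite infinite tree that does not satisfy the neighbour sum property.
   Context: A tree is locally finite if every vertex has finite degree. A locally finite graph $\mathcal G=(\mathcal V,\mathcal E)$ satisfies the neighbour sum property if there exists $f:\mathcal V\to\mathbb R$ with $f\not\equiv 0$ such that $f(x)=\sum_{y:\{x,y\}\in\mathcal E} f(y)$ for every $x\in\mathcal V$. *)

(* Defs.v *)
From mathcomp Require Import all_boot all_order all_algebra.
From mathcomp Require Import all_classical all_reals.

Set Implicit Arguments.
Unset Strict Implicit.
Unset Printing Implicit Defensive.

Import GRing.Theory.

Local Open Scope classical_set_scope.
Local Open Scope ring_scope.

Record sgraph := SGraph {
  vertex :> choiceType;
  edge : rel vertex;
  edge_sym : symmetric edge;
  edge_irrefl : irreflexive edge
}.

Definition neighbours (G : sgraph) (x : G) : set G := [set y | edge x y].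

Definition locally_finite (G : sgraph) : Prop :=
  forall x : G, finite_set (neighbours x).

Definition infinite_graph (G : sgraph) : Prop := infinite_set [set: G].

Definition connected_graph (G : sgraph) : Prop :=
  [set: G] !=set0 /\
  forall x y : G, exists p : seq G, path (@edge G) x p /\ last x p = y.

(* A [ucycle] of length 1 is a loop and one of length 2 is an edge traversed
   back and forth, hence the bound on the size. *)
Definition acyclic_graph (G : sgraph) : Prop :=
  ~ exists c : seq G, (2 < size c)%N /\ ucycle (@edge G) c.

Definition tree (G : sgraph) : Prop := connected_graph G /\ acyclic_graph G.

(* [\sum_(y \in A) F y] is the usual finite sum whenever [A] is finite, so this
   is only meaningful for locally finite [G]. *)
Definition neighbour_sum_property (R : realType) (G : sgraph) : Prop :=
  exists f : G -> R,
    (exists x, f x <> 0) /\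
    forall x, f x = \sum_(y \in neighbours x) f y.

(* Main.v *)
(** The tree is the comb obtained from a one-way infinite path x_0, x_1, ... by
    attaching a pendant path x_k - v_k - l_k at each x_k.  The equation at the
    leaf l_k gives f(l_k) = f(v_k), so the equation at v_k gives f(x_k) = 0.
    As this holds for every k, the equation at x_k reduces to f(v_k) = 0. *)
Require Import Defs.
From mathcomp Require Import all_boot all_order all_algebra.
From mathcomp Require Import all_classical all_reals.
From mathcomp Require Import zify.

Import GRing.Theory.

Local Open Scope classical_set_scope.

Section ParentGraph.
Variable p : nat -> nat.

(** The conjunct [m != n] removes the loop at the root 0, which is its own parent once [p n <= n.-1]
    is assumed. *)
Definition parent_edge : rel nat :=
  fun m n => (m != n) && ((m == p n) || (n == p m)).

Lemma parent_edge_sym : symmetric parent_edge.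
Proof. by move=> m n; rewrite /parent_edge eq_sym orbC. Qed.

Lemma parent_edge_irrefl : irreflexive parent_edge.
Proof. by move=> m; rewrite /parent_edge eqxx. Qed.

Definition parent_graph : sgraph := SGraph parent_edge_sym parent_edge_irrefl.

Hypothesis p_lt : forall n, p n <= n.-1.

Lemma parent_edge_le m n : parent_edge m n -> n <= m -> n = p m.
Proof. by move=> /andP[/eqP mn /orP[/eqP e|/eqP//]]; have := p_lt n; lia. Qed.

Lemma path_to_root n : exists s, path parent_edge n s /\ last n s = 0.
Proof.
elim/ltn_ind: n => -[_|n IHn]; first by exists [::].
have pn := p_lt n.+1; have [s [ps ls]] := IHn (p n.+1) pn.
exists (p n.+1 :: s); split=> //=; rewrite ps andbT /parent_edge eqxx orbT andbT.
by rewrite gtn_eqF.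
Qed.

Lemma connected_parent_graph : connected_graph parent_graph.
Proof.
split; first by exists 0.
move=> x y; have [s [ps ls]] := path_to_root x; have [t [pt lt]] := path_to_root y.
(* Descend from [x] to the root, then climb to [y]; [belast] drops the root, already reached at the
   end of [s]. *)
exists (s ++ rev (belast y t)); rewrite cat_path last_cat ps ls -lt; split.
  by rewrite (eq_path parent_edge_sym) rev_path.
by case: t {pt lt} => //= a t; rewrite rev_cons last_rcons.
Qed.

(* Both cycle-neighbours of the largest vertex of a cycle are its parent. *)
Lemma acyclic_parent_graph : acyclic_graph parent_graph.
Proof.
case=> c [c2 /andP[cyc Uc]].
have [m mc mmax] : exists2 m, m \in c & forall n, n \in c -> n <= m.
  have exc : exists n, n \in c by exists (head 0 c); case: (c) c2 => //= *; exact: mem_head.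
  have ubc n : n \in c -> n <= \max_(i <- c) i.
    by move=> nc; exact: (@leq_bigmax_seq _ c xpredT id).
  by case: (ex_maxnP exc ubc) => m mc mmax; exists m.
have [i s rotc] := rot_to mc.
move: cyc Uc c2; rewrite -(rot_cycle i) -(rot_uniq i) -(size_rot i) rotc => cyc Us ss.
have {}mmax n : n \in s -> n <= m.
  by move=> ns; apply: mmax; rewrite -(mem_rot i) rotc inE ns orbT.
(* A size above 2 puts the two cycle-neighbours [a] and [b] of [m] at distinct positions. *)
case/lastP: s => [//|s b] in rotc cyc Us ss mmax *.
case: s => [//|a s] in rotc cyc Us ss mmax *.
move: cyc; rewrite /= rcons_path last_rcons => /and3P[ma _ bm].
have ea : a = p m by apply: parent_edge_le ma _; apply: mmax; exact: mem_head.
have eb : b = p m.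
  apply: parent_edge_le; first by rewrite parent_edge_sym.
  by apply: mmax; rewrite mem_rcons mem_head.
by move: Us; rewrite /= ea eb mem_rcons mem_head andbF.
Qed.

Lemma tree_parent_graph : tree parent_graph.
Proof. by split; [exact: connected_parent_graph|exact: acyclic_parent_graph]. Qed.

End ParentGraph.

(* x_k, v_k and l_k are encoded as 3k, 3k+1 and 3k+2. *)
Definition comb_parent n := if 3 %| n then n - 3 else n.-1.

Definition comb := parent_graph comb_parent.

Lemma comb_parent_lt n : comb_parent n <= n.-1.
Proof. by rewrite /comb_parent; case: ifP; lia. Qed.

Lemma neighbours_combE (n m : nat) : neighbours (n : comb) m =
  ((n != m) && ((n == comb_parent m) || (m == comb_parent n))) :> Prop.
Proof. by []. Qed.

Lemma locally_finite_comb : locally_finite comb.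
Proof.
(* The largest possible neighbour is [n + 3], the next spine vertex. *)
move=> n; apply: (sub_finite_set _ (finite_II n.+4)) => m.
by rewrite neighbours_combE /= /comb_parent; do 2 case: ifP; lia.
Qed.

Lemma infinite_comb : infinite_graph comb.
Proof. exact: infinite_nat. Qed.

Lemma neighbours_leaf k : neighbours (k * 3 + 2 : comb) = [set k * 3 + 1].
Proof.
apply/seteqP; split=> m; rewrite neighbours_combE /comb_parent;
  by rewrite /=; do 2 case: ifP; lia.
Qed.

Lemma neighbours_middle k :
  neighbours (k * 3 + 1 : comb) = [set k * 3; k * 3 + 2].
Proof.
apply/seteqP; split=> m; rewrite neighbours_combE /comb_parent;
  by rewrite /=; do 2 case: ifP; lia.
Qed.

(** An inclusion suffices, since [f] vanishes on the whole spine; this avoids treating the end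
    [k = 0] separately. *)
Lemma neighbours_spine k n : neighbours (k * 3 : comb) n ->
  n = k * 3 + 1 \/ exists j, n = j * 3.
Proof.
move=> h; have : n = k * 3 + 1 \/ n = (n %/ 3) * 3.
  by move: h; rewrite neighbours_combE /comb_parent; do 2 case: ifP; lia.
by case; [left|right; exists (n %/ 3)].
Qed.

Lemma comb_not_neighbour_sum (R : realType) : ~ neighbour_sum_property R comb.
Proof.
move=> [f [[x fx0] fE]].
have fl k : f (k * 3 + 2) = f (k * 3 + 1).
  by rewrite fE neighbours_leaf fsbig_set1.
have fs k : f (k * 3) = 0%R.
  have := fE (k * 3 + 1); rewrite neighbours_middle fsbigU//=; last first.
    by move=> i [-> /=]; lia.
  by rewrite !fsbig_set1 fl => /eqP; rewrite -subr_eq subrr => /eqP.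
have fm k : f (k * 3 + 1) = 0%R.
  (* Read 0 as [f (k * 3)], expand it over the neighbours, and shrink the sum to the single
     non-spine neighbour. *)
  rewrite -(fs k) [RHS]fE -(@fsbig_widen _ _ _ _ [set k * 3 + 1]) ?fsbig_set1//.
    by move=> n /= ->; rewrite neighbours_combE /comb_parent; do 2 case: ifP; lia.
  by move=> n [/neighbours_spine[-> []|[j ->] _] /=]; rewrite ?fs.
apply: fx0; have [e|[e|e]] : x = x %/ 3 * 3 \/ x = x %/ 3 * 3 + 1 \/ x = x %/ 3 * 3 + 2.
- by move: x => /= x; lia.
- by rewrite e.
- by rewrite e.
- by rewrite e fl.
Qed.

Theorem theorem5p2 (R : realType) :
  exists G : sgraph,
    [/\ tree G, locally_finite G, infinite_graph G
      & ~ neighbour_sum_property R G].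
Proof.
exists comb; split.
- exact: tree_parent_graph comb_parent_lt.
- exact: locally_finite_comb.
- exact: infinite_comb.
- exact: comb_not_neighbour_sum.
Qed.
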